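(* Let $r\ge 3$ and $t\ge 1$ be integers, let $s=\lfloor (t-1)/2\rfloor$, and let $\mathcal{C}$ be an $(n,k,r,t)_{\mathrm{seq}}$ code over a finite field $\mathbb{F}_q$. Then $$\frac{k}{n}\le \frac{r^{s+1}}{r^{s+1}+2\sum_{i=0}^{s}r^i}\quad\text{if $t$ is even},\qquad \frac{k}{n}\le \frac{r^{s+1}}{r^{s+1}+2\sum_{i=1}^{s}r^i+1}\quad\text{if $t$ is odd}.$$
   Context: Sequential-recovery LRC: Let $\mathbb{F}_q$ be a finite field and $n,k,r,t$ positive integers. An $(n,k,r,t)_{\mathrm{seq}}$ code is an $[n,k]$ linear code $\mathcal{C}\subseteq\mathbb{F}_q^n$ (length $n$, dimension $k$) with the following property: for every set $E\subseteq[n]$ with $1\le |E|=u\le t$ there is an ordering $\ell_1,\dots,\ell_u$ of the elements of $E$ and, for each $j\in[u]$, a set $R_j\subseteq[n]$ with $|R_j|\le r$ and $R_j\cap\{\ell_j,\ell_{j+1},\dots,\ell_u\}=\emptyset$, together with coefficients $a_{j,i}\in\mathbb{F}_q$ ($i\in R_j$), such that $c_{\ell_j}=\sum_{i\in R_j}a_{j,i}c_i$ for every codeword $c=(c_1,\dots,c_n)\in\mathcal{C}$. *)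

(* Defs.v *)
From HB Require Import structures.
From mathcomp Require Import all_boot all_order all_algebra.
Set Implicit Arguments. Unset Strict Implicit. Unset Printing Implicit Defensive.
Import Order.TTheory GRing.Theory Num.Theory.

Local Open Scope ring_scope.

(* (n,k,r,t)_seq property (sequential recovery with locality r for up to t
   erasures).  For every erasure set E with 1 <= |E| <= t there is an ordering
   s = [l_1; ...; l_u] of E such that for every position j (written as a split
   s = s1 ++ l_j :: s2, so that l_j :: s2 = {l_j,...,l_u}) there is a recovery
   set R with |R| <= r disjoint from {l_j,...,l_u} and coefficients a with
   c_{l_j} = sum_{i in R} a_i c_i for every codeword c. *)
Definition seq_recovery (F : fieldType) (n : nat) (C : {vspace 'rV[F]_n})
    (r t : nat) : Prop :=
  forall E : {set 'I_n}, (0 < #|E| <= t)%N ->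
  exists s : seq 'I_n, perm_eq s (enum E) /\
    forall (s1 s2 : seq 'I_n) (l : 'I_n), s = s1 ++ l :: s2 ->
    exists (R : {set 'I_n}) (a : 'I_n -> F),
      [/\ (#|R| <= r)%N, [disjoint R & (l :: s2)] &
          forall c : 'rV[F]_n, c \in C -> c 0 l = \sum_(i in R) a i * c 0 i].

Definition seq_code (F : fieldType) (n : nat) (k r t : nat) (C : {vspace 'rV[F]_n}) : Prop :=
  \dim C = k /\ seq_recovery C r t.

Definition seq_rate_bound (r t : nat) : rat :=
  let s := (t.-1)./2 in
  if ~~ odd t then
    ((r ^ s.+1)%:R / (r ^ s.+1 + 2 * \sum_(0 <= i < s.+1) r ^ i)%N%:R)
  else
    ((r ^ s.+1)%:R / (r ^ s.+1 + 2 * \sum_(1 <= i < s.+1) r ^ i + 1)%N%:R).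

(* Main.v *)
(** Choose a basis, consisting of dual words of weight at most r+1, of the span
    of all such dual words, and let m <= n - k be its size. Sequential recovery
    makes any t columns of the resulting m x n matrix linearly independent, so
    any X of at most t columns meets at least #|X| rows; only this Hall
    condition and the bound r+1 on the row weights are needed from here on.

    Column sets meeting no more rows than they have columns ("tight" sets) are
    closed under union, by submodularity. Starting from the columns of weight 1
    and walking along columns of weight 2 (the edges of a graph on the rows),
    every row reached in i steps lies in the neighbourhood of a tight set of
    size at most i; hence the part explored within about t/2 steps is a forest.
    In the absence of columns of weight at least 3 and of rows of weight less
    than r+1, it therefore grows by a factor r at each step, which bounds the
    number of columns of weight 1 in terms of m, and then n by counting
    incidences. Each defect of either kind costs less in this growth than it
    gains in the incidence count, because r >= 3. *)
Require Import Defs.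
From HB Require Import structures.
From mathcomp Require Import all_boot all_order all_algebra.
From mathcomp Require Import zify.
Import Order.TTheory GRing.Theory Num.Theory.
Set Implicit Arguments. Unset Strict Implicit. Unset Printing Implicit Defensive.
Local Open Scope nat_scope.

(** * Tight column sets under the Hall condition *)

Section Layers.

Variables (U V : finType) (N : V -> {set U}).

Definition nbhd (X : {set V}) : {set U} := \bigcup_(c in X) N c.

Definition hall t := forall X : {set V}, #|X| <= t -> #|X| <= #|nbhd X|.

Definition tight (X : {set V}) := #|nbhd X| <= #|X|.

(** The condition [N c \subset u |: M] treats both weights alike: columns of weight 1 start the
    exploration from [set0], columns of weight 2 extend it. *)
Definition layer_step (M : {set U}) : {set U} :=
  M :|: [set u | [exists c, [&& #|N c| <= 2, u \in N c & N c \subset u |: M]]].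

Definition layer i := iter i layer_step set0.

Definition inner (M : {set U}) := [set c | (#|N c| <= 2) && (N c \subset M)].

Definition bdry (M : {set U}) := [set c | (#|N c| <= 2) && (#|N c :\: M| == 1)].

Definition deg (u : U) := #|[set c | u \in N c]|.

Definition nleaf := #|[set c | #|N c| == 1]|.

Definition excess := \sum_(c | 2 < #|N c|) (#|N c| - 2).

Lemma nbhdU X Y : nbhd (X :|: Y) = nbhd X :|: nbhd Y.
Proof. by rewrite /nbhd bigcup_setU. Qed.

Lemma nbhd1 c : nbhd [set c] = N c.
Proof. by rewrite /nbhd big_set1. Qed.

Lemma sub_nbhd c (X : {set V}) : c \in X -> N c \subset nbhd X.
Proof. by move=> cX; apply: bigcup_sup. Qed.

Lemma tight0 : tight set0.
Proof. by rewrite /tight /nbhd big_set0 !cards0. Qed.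

Lemma tightU1 c v (X : {set V}) : c \notin X -> tight X -> N c \subset v |: nbhd X ->
  tight (c |: X).
Proof.
move=> cX tX sub; rewrite /tight nbhdU nbhd1 cardsU1 cX /=.
apply: leq_trans (_ : #|v |: nbhd X| <= _).
  by apply: subset_leq_card; rewrite subUset sub subsetUr.
by rewrite cardsU1; apply: leq_add => //; case: (_ \notin _).
Qed.

(* Submodularity of [X |-> #|nbhd X|]. *)
Lemma tightU t (X Y : {set V}) : hall t -> #|X| <= t -> tight X -> tight Y ->
  tight (X :|: Y).
Proof.
move=> Ht Xt tX tY; rewrite /tight nbhdU.
have sub : nbhd (X :&: Y) \subset nbhd X :&: nbhd Y.
  by apply/bigcupsP=> c /setIP[cX cY]; rewrite subsetI !sub_nbhd.
have h1 := subset_leq_card sub.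
have h2 : #|X :&: Y| <= #|nbhd (X :&: Y)|.
  by apply: Ht; apply: leq_trans Xt; apply: subset_leq_card; apply: subsetIl.
have := cardsUI X Y; have := cardsUI (nbhd X) (nbhd Y).
move: tX tY; rewrite /tight; lia.
Qed.

(** Otherwise adding [c] to the tight union would give at most [t] columns that meet fewer rows than
    their number. *)
Lemma no_chord t (X Y : {set V}) c : hall t -> tight X -> tight Y -> #|X| + #|Y| < t ->
  N c \subset nbhd X :|: nbhd Y -> c \in X :|: Y.
Proof.
move=> Ht tX tY XYt sub; apply/negPn/negP => cXY.
have tXY : tight (X :|: Y) by apply: (tightU Ht) => //; lia.
have XY := cardsUI X Y.
have : #|c |: (X :|: Y)| <= #|nbhd (c |: (X :|: Y))|.
  by apply: Ht; rewrite cardsU1 cXY; lia.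
rewrite -nbhdU in sub.
rewrite nbhdU nbhd1 (setUidPr sub) cardsU1 cXY.
by move: tXY; rewrite /tight; lia.
Qed.

(** * Growth of the layers *)

Lemma layerS_sub i : layer i \subset layer i.+1.
Proof. exact: subsetUl. Qed.

(** [A] may be empty so that the induction can pass from [u] to [N c :\ u] for weights 1 and 2 at
    once. The last clause later excludes columns with two new rows. *)
Lemma layer_tight_cover i (A : {set U}) : A \subset layer i -> #|A| <= 1 ->
  exists X : {set V}, [/\ #|X| <= i, tight X, A \subset nbhd X &
    forall c, c \in X -> N c \subset layer i /\ #|N c :\: layer i.-1| <= 1].
Proof.
elim: i A => [|i IH] A sA A1.
  exists set0; split; rewrite ?cards0 ?tight0 //.
    by move: sA; rewrite subset0 => /eqP ->; rewrite sub0set.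
  by move=> c; rewrite inE.
have IH' (B : {set U}) : B \subset layer i -> #|B| <= 1 ->
    exists X : {set V}, [/\ #|X| <= i, tight X, B \subset nbhd X &
      forall c, c \in X -> N c \subset layer i].
  move=> sB B1; have [X [X1 X2 X3 X4]] := IH _ sB B1.
  by exists X; split=> // c /X4[].
have [sAi|] := boolP (A \subset layer i).
  have [X [X1 X2 X3 X4]] := IH' _ sAi A1; exists X; split=> //; first exact: leqW.
  move=> c /X4 h; split; first exact: subset_trans h (layerS_sub i).
  by move: h; rewrite /= -setD_eq0 => /eqP ->; rewrite cards0.
case/subsetPn=> u uA ui.
have eA : A = [set u].
  by apply/eqP; rewrite eq_sym eqEcard sub1set uA cards1.
have /setUP[|] := subsetP sA _ uA; first by rewrite (negPf ui).
rewrite inE => /existsP[c /and3P[c2 uc sc]].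
have sB : N c :\ u \subset layer i by rewrite subDset.
have B1 : #|N c :\ u| <= 1 by move: c2; rewrite (cardsD1 u) uc.
have [X [X1 X2 X3 X4]] := IH' _ sB B1.
have cX : c \notin X.
  by apply: contra ui => /X4/subsetP; apply.
have scX : N c \subset u |: nbhd X by rewrite -subDset.
exists (c |: X); split.
- by rewrite cardsU1 cX; lia.
- exact: tightU1 scX.
- by rewrite eA nbhdU nbhd1 sub1set inE uc.
- move=> d /setU1P[->|/X4 h] /=.
    split; last first.
      rewrite -(cards1 u); apply: subset_leq_card; rewrite subDset setUC.
      exact: sc.
    apply: subset_trans sc _; rewrite subUset layerS_sub sub1set (subsetP sA) //.
  split; first exact: subset_trans h (layerS_sub i).
  by move: h; rewrite -setD_eq0 => /eqP ->; rewrite cards0.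
Qed.

(** Boundary columns [c] and [d] with the same new row would close a cycle: the tight sets [c |: X]
    and [Y], of sizes at most [i + 1] and [i], cover [d] without containing it, against
    [no_chord]. *)
Lemma card_layerS t i : hall t -> i.*2.+2 <= t ->
  #|layer i| + #|bdry (layer i)| <= #|layer i.+1|.
Proof.
move=> Ht it; set M := layer i.
have -> : #|layer i.+1| = #|M| + #|layer i.+1 :\: M|.
  by rewrite -(cardsID M (layer i.+1)) (setIidPr (layerS_sub i)).
rewrite leq_add2l.
pose f c := [pick u in N c :\: M].
have fP c : c \in bdry M -> exists2 v, f c = Some v & N c :\: M = [set v].
  rewrite inE => /andP[_ /cards1P[v ev]]; exists v => //.
  rewrite /f; case: pickP => [w|/(_ v)]; rewrite ev inE ?eqxx //.
  by move/eqP->.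
have injf : {in bdry M &, injective f}.
  move=> c d cB dB efcd; have [v fc Nc] := fP _ cB; have [w fd Nd] := fP _ dB.
  have evw : v = w by move: efcd; rewrite fc fd => -[].
  rewrite -evw in Nd.
  have vN e : N e :\: M = [set v] -> (v \in N e) && (v \notin M).
    by move=> Ne; have := set11 v; rewrite -Ne inE andbC.
  have cover e : e \in bdry M -> N e :\: M = [set v] ->
      exists X : {set V}, [/\ #|X| <= i, tight X, N e \subset v |: nbhd X &
        forall g, g \in X -> v \notin N g].
    rewrite inE => /andP[e2 _] Ne; have /andP[ve vM] := vN _ Ne.
    have sB : N e :\ v \subset layer i.
      by rewrite subDset -Ne setUC -subDset.
    have B1 : #|N e :\ v| <= 1 by move: e2; rewrite (cardsD1 v) ve.
    have [X [X1 X2 X3 X4]] := layer_tight_cover sB B1.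
    exists X; split=> //; first by rewrite -subDset.
    by move=> g /X4[/subsetP h _]; apply: contra vM => /h.
  have [X [X1 X2 X3 X4]] := cover _ cB Nc.
  have [Y [Y1 Y2 Y3 Y4]] := cover _ dB Nd.
  have /andP[vc _] := vN _ Nc; have /andP[vd _] := vN _ Nd.
  have cX : c \notin X by apply/negP => /X4; rewrite vc.
  have : d \in (c |: X) :|: Y.
    apply: (no_chord Ht) => //; first exact: tightU1 X3.
      by rewrite cardsU1 cX; lia.
    apply: subset_trans Y3 _; apply: setSU.
    by rewrite sub1set nbhdU nbhd1 inE vc.
  case/setUP=> [/setU1P[//|/X4]|/Y4]; by rewrite vd.
rewrite -(card_in_imset injf).
apply: leq_trans (leq_imset_card Some (layer i.+1 :\: M)).
apply: subset_leq_card; apply/subsetP=> _ /imsetP[c cB ->].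
have [v -> Nc] := fP _ cB; apply: imset_f.
have : v \in N c :\: M by rewrite Nc set11.
rewrite !inE => /andP[-> vc] /=; apply/orP; right; apply/existsP; exists c.
move: cB; rewrite inE => /andP[-> _]; rewrite vc /=.
by rewrite -Nc setUC -subDset.
Qed.

(** Inner columns of the next layer are inner or boundary columns of the current one, and each
    boundary column brings its own new row. *)
Lemma card_inner_layer t i : hall t -> i.*2 < t ->
  #|inner (layer i)| <= #|layer i|.
Proof.
move=> Ht; elim: i => [|i IH] it.
  have -> : inner (layer 0) = set0; last by rewrite cards0.
  apply/setP=> c; rewrite !inE subset0; apply/negP => /andP[_ /eqP Nc].
  by have := Ht [set c]; rewrite nbhd1 Nc cards0 cards1; lia.
apply: leq_trans (card_layerS (t := t) Ht _); last by lia.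
apply: leq_trans (leq_add (IH _) (leqnn _)); last by lia.
rewrite -cardsUI; apply: leq_trans (leq_addr _ _).
apply: subset_leq_card; apply/subsetP=> c.
rewrite !inE => /andP[c2 sc]; rewrite c2 /=.
rewrite -setD_eq0 -cards_eq0.
case E: #|_ :\: _| => [|[|k]] //=.
(* The remaining case has both rows of [c] new. By [no_chord] one of the tight sets covering these
   rows contains [c], but their columns have at most one new row. *)
have eN : N c :\: layer i = N c.
  by apply/eqP; rewrite eqEcard subsetDl E; lia.
have /cards2P[u [v [_ Nc]]] : #|N c| == 2.
  by move: E c2; rewrite eN => ->; case: k.
have cover w : w \in N c -> exists X : {set V}, [/\ #|X| <= i.+1, tight X,
    [set w] \subset nbhd X & forall d, d \in X -> N d \subset layer i.+1 /\
      #|N d :\: layer i| <= 1].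
  by move=> wc; apply: layer_tight_cover; rewrite ?cards1 // sub1set (subsetP sc).
have [|X [X1 X2 X3 X4]] := cover u; first by rewrite Nc !inE eqxx.
have [|Y [Y1 Y2 Y3 Y4]] := cover v; first by rewrite Nc !inE eqxx orbT.
have : c \in X :|: Y.
  apply: (no_chord Ht) => //; first by lia.
  by rewrite Nc; apply: setUSS.
by case/setUP=> [/X4|/Y4] [_]; rewrite E.
Qed.

(** * Incidence counts *)

Lemma sum_deg (M : {set U}) : \sum_(u in M) deg u = \sum_c #|N c :&: M|.
Proof.
rewrite /deg (eq_bigr (fun u => \sum_(c | u \in N c) 1)); last first.
  by move=> u _; rewrite -sum1_card; apply: eq_bigl => c; rewrite inE.
rewrite (exchange_big_dep xpredT) //=; apply: eq_bigr => c _.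
by rewrite -sum1_card; apply: eq_bigl => u; rewrite !inE andbC.
Qed.

Lemma card_nat (P : pred V) : #|[set c | P c]| = \sum_c P c.
Proof.
rewrite -sum1_card big_mkcond; apply: eq_bigr => c _.
by rewrite inE; case: (P c).
Qed.

(** Holds column by column; the factor 3 comes from [w <= 3 * (w - 2)] for weights [w >= 3]. *)
Lemma sum_deg_layer (M : {set U}) :
  \sum_(u in M) deg u + nleaf <= 2 * #|inner M| + #|bdry M| + 3 * excess.
Proof.
rewrite sum_deg /nleaf /inner /bdry !card_nat /excess.
rewrite (big_mkcond (fun c => 2 < #|N c|)) /=.
rewrite !big_distrr -!big_split /=; apply: leq_sum => c _.
have := cardsID M (N c); rewrite -setD_eq0 -cards_eq0.
case: ltnP; lia.
Qed.

Lemma sum_deg_total : (forall c, N c != set0) ->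
  \sum_u deg u + nleaf = 2 * #|V| + excess.
Proof.
move=> N0; have -> : \sum_u deg u = \sum_(u in [set: U]) deg u.
  by apply: eq_bigl => u; rewrite inE.
rewrite sum_deg -sum1_card /nleaf card_nat /excess.
rewrite (big_mkcond (fun c => 2 < #|N c|)) /=.
rewrite !big_distrr -!big_split /=; apply: eq_bigr => c _.
rewrite setIT; have := N0 c; rewrite -cards_eq0; case: ltnP; lia.
Qed.


(** * Rate bounds from the Hall condition *)

Section RateBound.

Variables (r t : nat).
Hypotheses (r_ge3 : 3 <= r) (t_gt0 : 0 < t) (Nhall : hall t).
Hypothesis deg_le : forall u, deg u <= r.+1.

Definition deficit := \sum_u (r.+1 - deg u).

Definition geom k := \sum_(0 <= i < k) r ^ i.

Lemma geomS k : geom k.+1 = r * geom k + 1.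
Proof.
rewrite /geom big_nat_recl // expn0 addnC big_distrr /=.
by congr (_ + _); apply: eq_bigr => i _; rewrite expnS.
Qed.

Lemma geom_expn k : r ^ k + geom k = r * geom k + 1.
Proof. by rewrite -geomS /geom big_nat_recr //= addnC. Qed.

Lemma deficit_ge (M : {set U}) :
  r.+1 * #|M| <= \sum_(u in M) deg u + deficit.
Proof.
rewrite mulnC -sum_nat_const /deficit [X in _ + X](bigID (mem M)) /=.
rewrite addnA -big_split /=; apply: leq_trans (leq_addr _ _).
by apply: leq_sum => u _; rewrite subnKC.
Qed.

Lemma sum_deg_deficit : \sum_u deg u + deficit = r.+1 * #|U|.
Proof.
rewrite -big_split /= (eq_bigr (fun=> r.+1)) ?sum_nat_const; first by rewrite mulnC.
by move=> u _; rewrite subnKC.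
Qed.

Lemma incidence_count :
  2 * #|V| + excess + deficit = r.+1 * #|U| + nleaf.
Proof.
have N0 c : N c != set0.
  by rewrite -card_gt0 -nbhd1; apply: leq_trans (Nhall _); rewrite ?cards1.
by rewrite -sum_deg_deficit -(sum_deg_total N0) addnAC.
Qed.

(** Inner columns absorb at most [2 * #|layer i|]; the rest goes to boundary columns or is charged
    to the defects. *)
Lemma bdry_layer_ge i : i.*2 < t ->
  r.+1 * #|layer i| + nleaf <=
  2 * #|layer i| + #|bdry (layer i)| + (3 * excess + deficit).
Proof.
move=> it; have := card_inner_layer Nhall it.
have := sum_deg_layer (layer i); have := deficit_ge (layer i).
lia.
Qed.

Lemma nleaf_le_bdry0 : nleaf <= #|bdry set0|.
Proof.
apply: subset_leq_card; apply/subsetP=> c; rewrite !inE setD0 => /eqP ->.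
by rewrite eqxx.
Qed.

(** Iterates [r * #|layer i| + nleaf <= #|layer i.+1| + D], where [D] is the charge for defects. The
    first step, from the empty layer, costs no [D]; hence the factor [geom i.-1]. *)
Lemma layer_growth i : i.*2 <= t ->
  geom i * nleaf <= #|layer i| + geom i.-1 * (3 * excess + deficit).
Proof.
elim: i => [|i IH] it; first by rewrite /geom big_geq.
have b1 : #|layer i| + #|bdry (layer i)| <= #|layer i.+1|.
  by apply: card_layerS Nhall _; lia.
case: i IH it b1 => [|i] IH it b1.
  move: b1; rewrite geomS /geom big_geq //= cards0 muln0 !add0n mul1n addn0.
  exact: leq_trans nleaf_le_bdry0.
have h1 := leq_mul (leqnn r) (IH (ltnW (ltnW it))).
have h2 := @bdry_layer_ge i.+1 (ltnW it).
rewrite [i.+2.-1]succnK (geomS i.+1) (geomS i); rewrite [i.+1.-1]succnK geomS in h1.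
lia.
Qed.

Lemma hall_bound_even s : t = s.*2.+2 ->
  #|V| * (2 * geom s.+1) <= #|U| * (r ^ s.+1 + 2 * geom s.+1).
Proof.
move=> et; have := layer_growth (i := s.+1); rewrite et => /(_ (leqnn _)) /=.
have := max_card (mem (layer s.+1)); have := incidence_count.
have := geom_expn s.+1; have := geomS s.
move: (geom s.+1) (geom s) (r ^ s.+1) => S S' P eS eP cnt bU grow.
have h1 : S * nleaf <= #|U| + S' * (3 * excess + deficit).
  by apply: leq_trans grow _; rewrite leq_add2r.
(* Since [S = r * S' + 1] and [r >= 3], the loss in growth is at most the gain in the incidence
   count. *)
have h2 : S' * (3 * excess + deficit) <= S * (excess + deficit) by nia.
have h3 : S * (2 * #|V| + excess + deficit) = S * (r.+1 * #|U| + nleaf).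
  by rewrite cnt.
have h4 : #|U| * (P + S) = #|U| * (r * S + 1) by rewrite eP.
move: #|U| #|V| nleaf excess deficit h1 h2 h3 h4 {cnt bU grow} => m n l e d.
lia.
Qed.

(** Boundary columns of layer [s] may now share outside rows, so they are counted through the
    degrees of those rows ([out]). *)
Lemma hall_bound_odd s : t = s.*2.+1 ->
  #|V| * (2 * r * geom s + 1) <= #|U| * (r ^ s.+1 + 2 * r * geom s + 1).
Proof.
move=> et; have := layer_growth (i := s); rewrite et => /(_ (leqnSn _)) /=.
have := bdry_layer_ge (i := s); rewrite et => /(_ (leqnn _)).
have out : #|layer s| * r.+1 + #|bdry (layer s)| <= #|U| * r.+1.
  rewrite -(cardsC (layer s)) mulnDl leq_add2l -sum_nat_const.
  apply: (@leq_trans (\sum_(u in ~: layer s) deg u)); last exact: leq_sum.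
  rewrite sum_deg /bdry card_nat; apply: leq_sum => c _.
  by rewrite -setDE; lia.
have := incidence_count; have := geom_expn s; rewrite expnS.
case: s et out => [|s] et out eP cnt bd grow.
  (* For [t = 1] the charge in [bdry_layer_ge] would exceed the gain; [nleaf_le_bdry0] has no
     charge. *)
  have n0 : #|layer 0| = 0 by rewrite cards0.
  have := nleaf_le_bdry0; rewrite -[set0]/(layer 0) /geom big_geq //.
  rewrite expn0 !muln0 muln1; move: out cnt; rewrite n0 mul0n.
  move: #|U| #|V| #|bdry _| => m n b; lia.
move: grow eP; rewrite [s.+1.-1]succnK (geomS s).
move: #|U| #|V| #|layer _| #|bdry _| out bd cnt => m n b c.
move: nleaf excess deficit (geom s) (r ^ s.+1) => l e d S' P.
move=> out bd cnt grow eP.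
set D := 3 * e + d in bd grow.
set T' := 2 * r * S' + 1; set T := 2 * r * (r * S' + 1) + 1.
(* [bd] and [out] give [2 * r * c + l <= r.+1 * m + D]; adding [2 * r] times [grow] eliminates
   [c]. *)
have h1 : T * l <= r.+1 * m + T' * D.
  have := leq_mul (leqnn (2 * r)) grow; rewrite /T /T'.
  by move: (D) bd => D0 bd; lia.
have h2 : T' * D <= T * (e + d) by rewrite /T /T' /D; nia.
have h3 : T * (2 * n + e + d) = T * (r.+1 * m + l) by rewrite cnt.
have h4 : 2 * (r * P) + 2 * T = T * r.+1 + r.+1.
  have := congr1 (muln (2 * r)) eP; rewrite /T; lia.
have h5 := congr1 (muln m) h4.
rewrite -[_ + _ + 1]addnA -/T; move: T T' D {h4 bd grow} h1 h2 h3 h5 => T T' D.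
lia.
Qed.

End RateBound.

End Layers.

Local Open Scope ring_scope.

(** * From sequential recovery to the Hall condition *)

Section ParityChecks.

Variable F : finFieldType.

Definition rsupp n (v : 'rV[F]_n) : {set 'I_n} := [set j | v 0 j != 0].

Definition col_supp m n (B : 'M[F]_(m, n)) (j : 'I_n) : {set 'I_m} :=
  [set i | B i j != 0].

(** Independent columns supported on the rows [Y] number at most [#|Y|], by factoring [M] through
    dimension [#|Y|]; a dependency, extended by zero, would contradict the hypothesis. *)
Lemma hall_col_supp m n (B : 'M[F]_(m, n)) t :
  (forall v : 'rV[F]_n, v != 0 -> (#|rsupp v| <= t)%N -> v *m B^T != 0) ->
  hall (col_supp B) t.
Proof.
move=> distB X Xt; set Y := nbhd _ X.
pose M := \matrix_(i < #|X|, j < m) B j (enum_val i).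
pose M1 := \matrix_(i < #|X|, k < #|Y|) B (enum_val k) (enum_val i).
pose M2 := \matrix_(k < #|Y|, j < m) (enum_val k == j)%:R : 'M[F]_(#|Y|, m).
have [freeM|] := boolP (row_free M).
  have eM : M = M1 *m M2.
    apply/matrixP=> i j; rewrite !mxE.
    have [jY|jY] := boolP (j \in Y).
      rewrite (bigD1 (enum_rank_in jY j)) //= !mxE enum_rankK_in // eqxx mulr1.
      rewrite big1 ?addr0 // => k kj; rewrite !mxE.
      case: eqP => [ek|]; last by rewrite mulr0.
      by case/eqP: kj; apply: enum_val_inj; rewrite enum_rankK_in.
    rewrite big1 => [|k _]; last first.
      rewrite !mxE; case: eqP => [ek|]; last by rewrite mulr0.
      by rewrite -ek enum_valP in jY.
    apply/eqP; apply: contraR jY => Bij.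
    by apply/bigcupP; exists (enum_val i); rewrite ?enum_valP // inE.
  by rewrite -{1}(eqP freeM) eM mulmx_max_rank.
rewrite -kermx_eq0 => /rowV0Pn[w /sub_kermxP wM w0].
pose v : 'rV[F]_n := w *m \matrix_(i < #|X|, j < n) (enum_val i == j)%:R.
have vE i : v 0 (enum_val i) = w 0 i.
  rewrite mxE (bigD1 i) //= mxE eqxx mulr1 big1 ?addr0 // => k ki.
  by rewrite mxE (inj_eq enum_val_inj) (negPf ki) mulr0.
have vX : rsupp v \subset X.
  apply/subsetP=> j; rewrite inE; apply: contraR => jX.
  rewrite mxE big1 // => k _; rewrite mxE.
  case: eqP => [ek|]; last by rewrite mulr0.
  by rewrite -ek enum_valP in jX.
have v0 : v != 0.
  apply: contraNneq w0 => v0; apply/eqP/rowP=> i.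
  by rewrite -vE v0 !mxE.
have := distB v v0 (leq_trans (subset_leq_card vX) Xt).
case/eqP; rewrite -{}wM /v -mulmxA; congr (_ *m _).
apply/matrixP=> i j; rewrite !mxE (bigD1 (enum_val i)) //= !mxE eqxx mul1r.
rewrite big1 ?addr0 // => k ki.
by rewrite !mxE eq_sym (negPf ki) mul0r.
Qed.

Definition light_checks n (C : {vspace 'rV[F]_n}) r : {set 'rV[F]_n} :=
  [set h | (#|rsupp h| <= r.+1)%N && [forall c in C, h *m c^T == 0]].

(* The first symbol to be recovered from the erasure pattern [rsupp v] is
   recovered by a light check that meets [rsupp v] in that symbol only. *)
Lemma seq_recovery_check n (C : {vspace 'rV[F]_n}) r t (v : 'rV[F]_n) :
  seq_recovery C r t -> v != 0 -> (#|rsupp v| <= t)%N ->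
  exists2 h, h \in light_checks C r & h *m v^T != 0.
Proof.
move=> rec v0 vt.
have E0 : (0 < #|rsupp v|)%N.
  rewrite card_gt0; apply: contraNneq v0 => E0; apply/eqP/rowP=> j.
  by apply/eqP; move/setP/(_ j): E0; rewrite !inE mxE => /negbFE.
have [s [ps /(_ [::])]] : exists s, _ := rec (rsupp v) (introT andP (conj E0 vt)).
case: s ps => [|l s] ps.
  by move/perm_size: ps; rewrite -cardE; move: E0; case: #|_|.
case/(_ s l erefl) => R [a [Rr dis recl]].
have lR : l \notin R by rewrite (disjointFl dis) // mem_head.
have RE i : i \in R -> v 0 i = 0.
  move=> iR; have := disjointFr dis iR; rewrite (perm_mem ps) mem_enum inE.
  by move/negbFE/eqP.
have vl : v 0 l != 0.
  by have := mem_head l s; rewrite (perm_mem ps) mem_enum inE.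
pose h : 'rV[F]_n := \row_j ((j == l)%:R - (j \in R)%:R * a j).
have hE (c : 'rV[F]_n) : (h *m c^T) 0 0 = c 0 l - \sum_(i in R) a i * c 0 i.
  rewrite mxE (eq_bigr (fun j => (j == l)%:R * c 0 j
    - (if j \in R then a j * c 0 j else 0))); last first.
    move=> j _; rewrite !mxE mulrBl; congr (_ - _).
    by case: (j \in R); rewrite ?mul1r ?mul0r.
  rewrite sumrB -big_mkcond; congr (_ - _).
  rewrite (bigD1 l) //= eqxx mul1r big1 ?addr0 // => j jl.
  by rewrite (negPf jl) mul0r.
exists h; last first.
  apply: contraNneq vl => /matrixP/(_ 0 0); rewrite hE mxE.
  by rewrite big1 ?subr0 => [->|i iR] //; rewrite RE ?mulr0.
rewrite inE; apply/andP; split.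
  apply: (@leq_trans #|l |: R|); last first.
    by rewrite cardsU1 lR add1n ltnS.
  apply: subset_leq_card; apply/subsetP=> j; rewrite !inE mxE.
  by apply: contraR; rewrite negb_or => /andP[/negPf -> /negPf ->]; rewrite mul0r subr0.
apply/forall_inP=> c cC; apply/eqP/matrixP=> i j.
by rewrite !ord1 hE (recl c cC) subrr mxE.
Qed.

Lemma light_check_basis n (C : {vspace 'rV[F]_n}) r t :
  seq_recovery C r t ->
  exists m (B : 'M[F]_(m, n)),
    [/\ (m + \dim C <= n)%N, forall i, (#|rsupp (row i B)| <= r.+1)%N &
        hall (col_supp B) t].
Proof.
move=> rec; pose A := \matrix_(i < #|light_checks C r|) (enum_val i : 'rV[F]_n).
pose B := rowsub (maxrankfun A) A.
have rB i : row i B \in light_checks C r.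
  by rewrite row_rowsub rowK enum_valP.
exists (\rank A), B; split.
(* The rows of [K] are a basis of [C], orthogonal to those of [B], so the two ranks add up to at
   most [n]. *)
- pose K := \matrix_(i < \dim C) (vbasis C)`_i.
  have KC i : row i K \in C.
    by rewrite rowK vbasis_mem // mem_nth // size_tuple.
  have rK : \rank K = \dim C.
    apply/eqP; rewrite -/(row_free K) -kermx_eq0; apply/negPn/negP.
    case/rowV0Pn=> w /sub_kermxP wK /negP[]; apply/eqP/rowP=> i.
    have /freeP := basis_free (vbasisP C).
    move/(_ (fun i => w 0 i)) => ->; rewrite ?mxE //.
    rewrite -[RHS]wK mulmx_sum_row; apply: eq_bigr => j _.
    by rewrite rowK.
  rewrite -rK -{1}(eq_maxrowsub A) -(mxrank_tr K).
  apply: mulmx0_rank_max; apply/matrixP=> i j.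
  have := rB i; rewrite inE => /andP[_ /forall_inP/(_ _ (KC j))/eqP/matrixP/(_ 0 0)].
  by rewrite !mxE => e0; rewrite -[RHS]e0; apply: eq_bigr => k _; rewrite !mxE.
- by move=> i; have := rB i; rewrite inE => /andP[].
apply: hall_col_supp => v v0 vt.
have [h hL] := seq_recovery_check rec v0 vt.
(* The rows of [B] span all light checks, so a word orthogonal to them is orthogonal to [h]. *)
apply: contraNneq => vB.
have : (h <= B)%MS.
  rewrite eq_maxrowsub -[h](enum_rankK_in hL hL).
  rewrite -(rowK (fun i => enum_val i : 'rV[F]_n)); exact: row_sub.
case/submxP=> D ->; rewrite -mulmxA.
by have /(congr1 trmx) := vB; rewrite trmx_mul trmxK trmx0 => ->; rewrite mulmx0.
Qed.

End ParityChecks.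

(** * The bound on the rate *)

Theorem mainTheorem1 (F : finFieldType) (n k r t : nat) (C : {vspace 'rV[F]_n}) :
  (3 <= r)%N -> (1 <= t)%N -> seq_code k r t C ->
  (k%:R / n%:R : rat) <= seq_rate_bound r t.
Proof.
move=> r3 t0 [<- /light_check_basis[m [B [mk rowB hallB]]]].
have degB i : (deg (col_supp B) i <= r.+1)%N.
  apply: leq_trans (rowB i); apply/eq_leq/eq_card => j.
  by rewrite !inE mxE.
have rate P T : (0 < P)%N -> (n * T <= m * (P + T))%N ->
    (\dim C)%:R / n%:R <= P%:R / (P + T)%:R :> rat.
  move: (\dim C) mk => d mk P0 nT.
  (* At length 0 the quotient is 0 by the convention for division. *)
  have [->|n0] := posnP n; first by rewrite invr0 mulr0 divr_ge0.
  rewrite ler_pdivrMr ?ltr0n // mulrAC ler_pdivlMr ?ltr0n ?addn_gt0 ?P0 //.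
  rewrite -!natrM ler_nat; nia.
have r0 s : (0 < r ^ s.+1)%N by rewrite expn_gt0 (ltn_trans _ r3).
rewrite /seq_rate_bound; case: ifPn => [even_t|]; last rewrite negbK => odd_t.
  apply: rate => //.
  have := hall_bound_even r3 t0 hallB degB (s := t.-1./2); rewrite !card_ord.
  by apply; lia.
rewrite -addnA; apply: rate => //.
have := hall_bound_odd r3 t0 hallB degB (s := t.-1./2); rewrite !card_ord.
have -> : (2 * r * geom r t.-1./2)%N = (2 * \sum_(1 <= i < t.-1./2.+1) r ^ i)%N.
  rewrite -mulnA big_add1 /= /geom big_distrr /=; congr (_ * _)%N.
  by apply: eq_bigr => i _; rewrite expnS.
by rewrite -addnA; apply; lia.
Qed.
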